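(* Let $\sigma_{PT}\approx0.72655\ldots$ be the unique positive solution of $8s^3+4s^2-3s-3=0$. There is a pointed metric space $(X,d,O)$ and a $4$-point set $P\subseteq X$ with $O\in P$ which is $(\sigma_{PT},\infty)$-one-stable and such that $M_{\sigma_{PT}}(P)=0$. In particular, $k\text{-}\mathrm{OneMinM}_{\sigma_{PT}}(X,d,O)=0$ for all integers $k\ge0$.
   Context: Let $(X,d,O)$ be a pointed metric space and $\sigma\in[\frac12,1]$. $B_\tau(q)\subseteq X$ is the open ball of radius $\tau$ centered at $q$, and $B_0(q):=\emptyset$. For a finite $P\subseteq X$ let $\mathcal R(P)$ be the set of functions $r:P\to[0,1]$ such that $B_{r(p)}(p)\cap B_{r(p')}(p')=\emptyset$ for all distinct $p,p'\in P$. For $r\in\mathcal R(P)$ set $U(P,r):=\bigcup_{p\in P}B_{r(p)}(p)$ and $R(P,r):=\inf\{R>0: B_R(O)\supset U(P,r)\}$, with the convention $\mathrm{diam}(U(P,r))=R(P,r)=0$ if $r\equiv0$. Define $$F_\sigma(P,r):=\sum_{p\in P}r(p)-\tfrac1{2\sigma}\min\{\mathrm{diam}(U(P,r)),\tfrac12+R(P,r)\},\qquad M_\sigma(P):=\sup\{F_\sigma(P,r): r\in\mathcal R(P)\}.$$ For $p\in X$, $\Delta_\sigma(p,1)$ is the set of pairs $(q_1,q_2)\in X\times X$ with $d(q_1,p)\le1$, $d(q_2,p)\le1$, $d(q_1,q_2)\ge2\sigma$. A set $P\subseteq X$ is $(\sigma,L)$-one-stable ($L>1$) if for every $p\in P\cap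 B_L(O)$ there is $(q_1,q_2)\in\Delta_\sigma(p,1)$ with $q_1,q_2\in P$; it is $(\sigma,\infty)$-one-stable if it is $(\sigma,L)$-one-stable for all $L>1$. Define $\mathcal F^{(X,d,O)}_\sigma(0):=\{\{O\}\}$ and $$\mathcal F^{(X,d,O)}_\sigma(k+1):=\Big\{P\cup\bigcup_{p\in P}\{q_{p,1},q_{p,2}\}: P\in\mathcal F^{(X,d,O)}_\sigma(k),\ (q_{p,1},q_{p,2})\in\Delta_\sigma(p,1)\text{ for all }p\in P\Big\},$$ and $k\text{-}\mathrm{OneMinM}_\sigma(X,d,O):=\inf_{P\in\mathcal F^{(X,d,O)}_\sigma(k)}M_\sigma(P)$ for integers $k\ge0$. *)

(* Defs.v *)
From HB Require Import structures.
From mathcomp Require Export all_boot all_order all_algebra finmap.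
From mathcomp Require Export all_classical all_reals all_analysis.
Set Implicit Arguments.
Unset Strict Implicit.
Unset Printing Implicit Defensive.
Import Order.TTheory GRing.Theory Num.Theory.

Local Open Scope fset_scope.
Local Open Scope classical_set_scope.
Local Open Scope ring_scope.

Section OneMin.
Context {R : realType} {X : metricType R}.
Implicit Types (sigma L : R) (O p : X) (P : {fset X}).

(* [ball q tau] is the open ball [set y | mdist q y < tau] for every tau
   (lemma ballEmdist); in particular it is empty for tau = 0. *)

Definition admissible P : set (P -> R) :=
  [set r | (forall p : P, 0 <= r p <= 1) /\
           (forall p p' : P, p != p' ->
              ball (val p) (r p) `&` ball (val p') (r p') = set0)].

Definition ball_union P (r : P -> R) : set X :=
  [set x | exists p : P, ball (val p) (r p) x].

Definition diameter (U : set X) : R :=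
  sup [set mdist z.1 z.2 | z in U `*` U].

Definition outer_radius O (U : set X) : R :=
  inf [set rho : R | 0 < rho /\ U `<=` ball O rho].

(* The convention diam = R = 0 for r = 0 needs no special case: the union of
   balls is then empty, and sup and inf above evaluate to 0. *)
Lemma ball_union0 P : ball_union (fun _ : P => 0) = set0.
Proof.
apply/seteqP; split=> // x [p]; rewrite ballEmdist /=.
by rewrite ltNge mdist_ge0.
Qed.

Lemma diameter0 : diameter set0 = 0.
Proof. by rewrite /diameter set0X image_set0 sup0. Qed.

Lemma outer_radius0 O : outer_radius O set0 = 0.
Proof.
rewrite /outer_radius.
have -> : [set rho : R | 0 < rho /\ set0 `<=` ball O rho] = `]0, +oo[%classic.
  by apply/seteqP; split=> x /=; rewrite in_itv/= andbT; [case|split].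
by rewrite inf_itv.
Qed.

Definition F_sigma sigma O P (r : P -> R) : R :=
  \sum_(p : P) r p
  - (2 * sigma)^-1 * Num.min (diameter (ball_union r))
                             (2^-1 + outer_radius O (ball_union r)).

Definition M_sigma sigma O P : \bar R :=
  ereal_sup [set (F_sigma sigma O r)%:E | r in @admissible P].

Definition Delta_sigma sigma p : set (X * X) :=
  [set q | [/\ mdist q.1 p <= 1, mdist q.2 p <= 1 &
               2 * sigma <= mdist q.1 q.2]].

(* (sigma, L)-one-stability, meant for 1 < L *)
Definition one_stable sigma L O (P : set X) : Prop :=
  forall p, (P `&` ball O L) p ->
    exists q, [/\ Delta_sigma sigma p q, P q.1 & P q.2].

Definition infty_one_stable sigma O (P : set X) : Prop :=
  forall L, 1 < L -> one_stable sigma L O P.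

Fixpoint config_family sigma O (k : nat) : set {fset X} :=
  if k is k'.+1 then
    [set P' | exists P, config_family sigma O k' P /\
       exists q : X -> X * X, (forall p, p \in P -> Delta_sigma sigma p (q p)) /\
         P' = (P `|` [fset (q p).1 | p in P] `|` [fset (q p).2 | p in P])%fset]
  else [set [fset O]%fset].

(* An extended real: the infimum is +oo when no such configuration exists. *)
Definition OneMinM sigma O (k : nat) : \bar R :=
  ereal_inf [set M_sigma sigma O P | P in config_family sigma O k].

End OneMin.

(* Main.v *)
(** Rich spaces make the disjointness constraints as strong, and the diameter
    and the outer radius as large, as the triangle inequality permits: in a
    normed space, disjoint balls with positive radii satisfy r + r' <= d(p, p'),
    the union has diameter at least d(p, p') + r + r' and outer radius at least
    d(O, p) + r.  For a finite P the inequality M_sigma(P) <= 0 then amounts to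
    finitely many linear programs, one per set of nonzero radii.

    P is the quadrilateral p0 = O, p1, p2, p3 in the plane with the sup norm with
    sides d01 = 1, d12 = 2 sigma - 1, d23 = 1, d30 = t and both diagonals equal
    to 2 sigma.  Balls at p1 and p3 alone force t >= 8 sigma^2 - 2 sigma - 2, balls
    at p0, p1 and p3 force (sigma + 1/2) t <= 2 - 2 sigma^2; both can hold with
    equality exactly when sigma is the root of the cubic, which determines t.  All
    other linear programs have slack.

    The inductive construction of configurations can be run inside P, and
    M_sigma is monotone in P, so the infimum over configurations is 0. *)
From HB Require Import structures.
Require Import Defs.
From mathcomp Require Import ring lra.
Import Order.TTheory GRing.Theory Num.Theory.
Import numFieldNormedType.Exports.
Set Implicit Arguments.
Unset Strict Implicit.
Unset Printing Implicit Defensive.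
Local Open Scope fset_scope.
Local Open Scope classical_set_scope.
Local Open Scope ring_scope.

(** * The linear programs of the quadrilateral *)

Lemma ge0_cases (R : realDomainType) (x : R) : 0 <= x -> x = 0 \/ 0 < x.
Proof. by rewrite le_eqVlt => /predU1P[<-|]; [left|right]. Qed.

Section LP.
Context {R : realFieldType}.
Implicit Types (s t r : R).

(** Rational bounds on the side [t]; they decide every program that has slack. *)
Lemma side_itv s : 29 / 40 < s < 8 / 11 ->
  3 / 4 < 8 * s ^+ 2 - 2 * s - 2 < 7 / 9.
Proof. by move=> /andP[? ?]; apply/andP; split; nra. Qed.

(* A ball of radius 0 is empty and constrains nothing, so every constraint is
   conditional on the radii involved being positive. *)
Lemma LP_diameter s t r0 r1 r2 r3 D :
  29 / 40 < s < 8 / 11 -> 3 / 4 < t < 7 / 9 ->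
  0 <= r0 <= 1 -> 0 <= r1 <= 1 -> 0 <= r2 <= 1 -> 0 <= r3 <= 1 ->
  (0 < r0) ==> (0 < r1) ==> (r0 + r1 <= 1) ->
  (0 < r0) ==> (0 < r2) ==> (r0 + r2 <= 2 * s) ->
  (0 < r0) ==> (0 < r3) ==> (r0 + r3 <= t) ->
  (0 < r1) ==> (0 < r2) ==> (r1 + r2 <= 2 * s - 1) ->
  (0 < r1) ==> (0 < r3) ==> (r1 + r3 <= 2 * s) ->
  (0 < r2) ==> (0 < r3) ==> (r2 + r3 <= 1) ->
  0 <= D -> (0 < r0) ==> (2 * r0 <= D) -> (0 < r1) ==> (2 * r1 <= D) ->
  (0 < r2) ==> (2 * r2 <= D) -> (0 < r3) ==> (2 * r3 <= D) ->
  (0 < r0) ==> (0 < r1) ==> (1 + (r0 + r1) <= D) ->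
  (0 < r0) ==> (0 < r2) ==> (2 * s + (r0 + r2) <= D) ->
  (0 < r0) ==> (0 < r3) ==> (t + (r0 + r3) <= D) ->
  (0 < r1) ==> (0 < r2) ==> (2 * s - 1 + (r1 + r2) <= D) ->
  (0 < r1) ==> (0 < r3) ==> (2 * s + (r1 + r3) <= D) ->
  (0 < r2) ==> (0 < r3) ==> (1 + (r2 + r3) <= D) ->
  2 * s * (r0 + r1 + r2 + r3) <= D.
Proof.
move=> s_itv t_itv /andP[r0_ge0 r0_le1] /andP[r1_ge0 r1_le1].
move=> /andP[r2_ge0 r2_le1] /andP[r3_ge0 r3_le1].
have s2 : 2 * s <= 16 / 11 by lra.
have sum_ge0 : 0 <= r0 + r1 + r2 + r3 by lra.
move=> c01 c02 c03 c12 c13 c23 D_ge0 D0 D1 D2 D3 D01 D02 D03 D12 D13 D23.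
(* Replacing [2 * s] by [16 / 11] removes the products of [s] with the radii, so each choice of
   nonzero radii is left to linear arithmetic. *)
apply: le_trans (ler_wpM2r sum_ge0 s2) _; clear sum_ge0.
move: c01 c02 c03 c12 c13 c23 D_ge0 D0 D1 D2 D3 D01 D02 D03 D12 D13 D23.
case: (ge0_cases r0_ge0) => e0; case: (ge0_cases r1_ge0) => e1;
  case: (ge0_cases r2_ge0) => e2; case: (ge0_cases r3_ge0) => e3;
  rewrite ?e0 ?e1 ?e2 ?e3 ?ltxx /= => *; lra.
Qed.

Lemma LP_radius s t r0 r1 r2 r3 Q :
  8 * s ^+ 3 + 4 * s ^+ 2 - 3 * s - 3 = 0 -> 29 / 40 < s < 8 / 11 ->
  t = 8 * s ^+ 2 - 2 * s - 2 ->
  0 <= r0 <= 1 -> 0 <= r1 <= 1 -> 0 <= r2 <= 1 -> 0 <= r3 <= 1 ->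
  (0 < r0) ==> (0 < r1) ==> (r0 + r1 <= 1) ->
  (0 < r0) ==> (0 < r2) ==> (r0 + r2 <= 2 * s) ->
  (0 < r0) ==> (0 < r3) ==> (r0 + r3 <= t) ->
  (0 < r1) ==> (0 < r2) ==> (r1 + r2 <= 2 * s - 1) ->
  (0 < r1) ==> (0 < r3) ==> (r1 + r3 <= 2 * s) ->
  (0 < r2) ==> (0 < r3) ==> (r2 + r3 <= 1) ->
  0 <= Q -> (0 < r0) ==> (r0 <= Q) -> (0 < r1) ==> (1 + r1 <= Q) ->
  (0 < r2) ==> (2 * s + r2 <= Q) -> (0 < r3) ==> (t + r3 <= Q) ->
  2 * s * (r0 + r1 + r2 + r3) <= 2^-1 + Q.
Proof.
move=> sE s_itv tE /andP[r0_ge0 r0_le1] /andP[r1_ge0 r1_le1].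
move=> /andP[r2_ge0 r2_le1] /andP[r3_ge0 r3_le1].
have s2 : 2 * s <= 16 / 11 by lra.
have sum_ge0 : 0 <= r0 + r1 + r2 + r3 by lra.
have t_itv := side_itv s_itv; rewrite -tE in t_itv.
have [/and3P[/eqP e2 e1 e3]|slack] := boolP [&& r2 == 0, 0 < r1 & 0 < r3].
  (* The tight cases: the factors 2 s - 1/2, s - 1/2 and s + 1/2 below are the
     optimal dual multipliers. *)
  case: (ge0_cases r0_ge0) => e0;
    rewrite ?e0 ?e1 ?e2 ?e3 ?ltxx /= => c01 _ c03 _ c13 _ _ _ Q1 _ Q3.
    have h13 : 0 <= (2 * s - 2^-1) * (2 * s - (r1 + r3)).
      by rewrite mulr_ge0 ?subr_ge0 //; lra.
    by rewrite tE in Q3; lra.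
  have h01 : 0 <= (s - 2^-1) * (1 - (r0 + r1)).
    by rewrite mulr_ge0 ?subr_ge0 //; lra.
  have h03 : 0 <= (s + 2^-1) * (t - (r0 + r3)).
    by rewrite mulr_ge0 ?subr_ge0 //; lra.
  have h13 : 0 <= (s - 2^-1) * (2 * s - (r1 + r3)).
    by rewrite mulr_ge0 ?subr_ge0 //; lra.
  (* With [t] expanded, what remains is [8 s^3 + 4 s^2 - 3 s - 3 <= 0], where [sE] gives
     equality. *)
  by rewrite tE in h03; lra.
move=> c01 c02 c03 c12 c13 c23 Q_ge0 Q0 Q1 Q2 Q3.
(* Outside the tight cases the rational bounds on [s] and [t] suffice; [slack] discards the tight
   ones in the case split. *)
apply: le_trans (ler_wpM2r sum_ge0 s2) _; clear sE tE sum_ge0.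
move: slack c01 c02 c03 c12 c13 c23 Q_ge0 Q0 Q1 Q2 Q3.
case: (ge0_cases r0_ge0) => e0; case: (ge0_cases r1_ge0) => e1;
  case: (ge0_cases r2_ge0) => e2; case: (ge0_cases r3_ge0) => e3;
  rewrite ?e0 ?e1 ?e2 ?e3 ?ltxx ?eqxx //= => *; lra.
Qed.

End LP.

(** * Diameter and outer radius of bounded sets *)

Section Bounded.
Context {R : realType} {X : metricType R}.
Implicit Types (O p : X) (U : set X).

(** Makes the distances in [diameter] bounded and the set of radii in [outer_radius] nonempty, so
    that [sup] and [inf] can be estimated. *)
Lemma ball_union_bounded O (P : {fset X}) (r : P -> R) :
  (forall p : P, r p <= 1) ->
  exists2 rho, 0 < rho & ball_union r `<=` ball O rho.
Proof.
move=> r_le1; exists (1 + \sum_(p : P) mdist O (val p)).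
  by rewrite ltr_pwDl ?sumr_ge0 // => p _; exact: mdist_ge0.
move=> x [p]; rewrite !ballEmdist /= => xp.
apply: le_lt_trans (metric_triangle _ (val p) _) _.
rewrite (bigD1 p) //= addrCA ler_ltD // (lt_le_trans xp) //.
by rewrite ler_wpDr // sumr_ge0 // => q _; exact: mdist_ge0.
Qed.

Lemma le_diameter O U rho x y :
  U `<=` ball O rho -> U x -> U y -> mdist x y <= diameter U.
Proof.
move=> UO Ux Uy; apply: ub_le_sup; last by exists (x, y).
exists (rho + rho) => _ [[a b] /= [/UO Oa /UO Ob] <-].
rewrite !ballEmdist /= in Oa Ob.
apply: le_trans (metric_triangle _ O _) _.
by rewrite lerD ?ltW // metric_sym.
Qed.

Lemma diameter_ge0 U : 0 <= diameter U.
Proof.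
rewrite /diameter.
(* The [sup] of an empty or unbounded set is 0 by default. *)
have [supU|/sup_out -> //] :=
  pselect (has_sup [set mdist z.1 z.2 | z in U `*` U]).
have [_ [z Uz _]] := supU.1.
by apply: le_trans (mdist_ge0 z.1 z.2) (ub_le_sup supU.2 _); exists z.
Qed.

Lemma outer_radius_ge0 O U : 0 <= outer_radius O U.
Proof.
rewrite /outer_radius; set A := [set _ | _].
have [->|/set0P A0] := eqVneq A set0; first by rewrite inf0.
by apply: lb_le_inf A0 _ => rho [/ltW].
Qed.

Lemma le_outer_radius O U rho x : 0 < rho -> U `<=` ball O rho ->
  U x -> mdist O x <= outer_radius O U.
Proof.
move=> rho0 UO Ux; apply: lb_le_inf; first by exists rho.
by move=> rho' [_ /(_ _ Ux)]; rewrite ballEmdist /= => /ltW.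
Qed.

End Bounded.

(** * Balls in a normed space *)

Definition normed_metric {R : realType} (V : normedModType R) : Type := V.

Section NormedMetric.
Context {R : realType} (V : normedModType R).

HB.instance Definition _ := NormedModule.on (normed_metric V).

Let dist (x y : normed_metric V) : R := `|y - x|.

Let dist_ge0 x y : 0 <= dist x y.
Proof. exact: normr_ge0. Qed.

Let dist_positivity x y : dist x y = 0 -> x = y.
Proof. by move/normr0_eq0/eqP; rewrite subr_eq0 => /eqP. Qed.

Let ballEdist x d : ball x d = [set y | dist x y < d].
Proof. by rewrite -ball_normE; apply/seteqP; split => y /=; rewrite distrC. Qed.

HB.instance Definition _ := PseudoMetric_isMetric.Build R (normed_metric V)
  dist_ge0 dist_positivity ballEdist.

Local Notation X := (normed_metric V).
Implicit Types (x y p O : X) (U : set X) (r s : R).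

Lemma normed_mdistE x y : mdist x y = `|y - x|.
Proof. by []. Qed.

(** If the centres were closer, the point dividing their segment in the ratio [r : s] would lie in
    both balls. A general metric space only gives the maximum of [r] and [s] as lower bound. *)
Lemma disjoint_ball_mdist x y r s : 0 < r -> 0 < s ->
  ball x r `&` ball y s = set0 -> r + s <= mdist x y.
Proof.
move=> r0 s0 disj; rewrite leNgt; apply/negP => lt_d.
have rs0 : 0 < r + s by rewrite addr_gt0.
have : (ball x r `&` ball y s) (x + (r / (r + s)) *: (y - x)).
  rewrite !ballEmdist /= !normed_mdistE; split.
    rewrite addrAC subrr add0r normrZ gtr0_norm ?divr_gt0 //.
    by rewrite mulrAC ltr_pdivrMr // ltr_pM2l.
  have -> : x + (r / (r + s)) *: (y - x) - y = - ((s / (r + s)) *: (y - x)).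
    have -> : s / (r + s) = 1 - r / (r + s) by field; rewrite gt_eqF.
    by rewrite scalerBl scale1r opprD opprB opprK addrAC.
  rewrite normrN normrZ gtr0_norm ?divr_gt0 //.
  by rewrite mulrAC ltr_pdivrMr // ltr_pM2l.
by rewrite disj.
Qed.

Hypothesis V_nontrivial : exists v : V, v != 0.

(** The case [v = 0] is included for coincident points: the diameter of a single ball, and the outer
    radius of a ball centred at [O]. *)
Lemma exists_direction (v : V) : exists2 u : V, `|u| = 1 & v = `|v| *: u.
Proof.
have dir (w : V) : w != 0 -> `| `|w|^-1 *: w| = 1.
  by move=> w0; rewrite normrZ normfV normr_id mulVf ?normr_eq0.
have [->|v0] := eqVneq v 0.
  have [w /dir w1] := V_nontrivial.
  by exists (`|w|^-1 *: w); rewrite // normr0 scale0r.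
exists (`|v|^-1 *: v); first exact: dir.
by rewrite scalerA mulfV ?normr_eq0 // scale1r.
Qed.

(** Move a point of each ball outwards along the line of centres. *)
Lemma diameter_balls O U rho x y r s : U `<=` ball O rho -> 0 < r -> 0 < s ->
  ball x r `<=` U -> ball y s `<=` U -> mdist x y + (r + s) <= diameter U.
Proof.
move=> UO r0 s0 xU yU; apply/ler_addgt0Pr => e e0.
have [u u1 yx] := exists_direction (y - x).
(* The balls are open, so the radius [a] is only approached: [c a] falls short of it by at most
   [e / 2], and is cut off at 0 to remain a length. *)
pose c a := Num.max (a - e / 2) 0.
have cE a : 0 < a -> 0 <= c a < a /\ a - e / 2 <= c a.
  by move=> a0; rewrite /c; case: (leP (a - e / 2) 0) => ?; split; lra.
have [/andP[cr0 cr] ler] := cE _ r0; have [/andP[cs0 cs] les] := cE _ s0.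
have xb : ball x r (x - c r *: u : X).
  by rewrite ballEmdist /= normed_mdistE addrAC subrr add0r normrN normrZ u1
    mulr1 ger0_norm.
have yb : ball y s (y + c s *: u : X).
  by rewrite ballEmdist /= normed_mdistE addrAC subrr add0r normrZ u1
    mulr1 ger0_norm.
have := le_diameter UO (xU _ xb) (yU _ yb); rewrite !normed_mdistE.
have -> : y + c s *: u - (x - c r *: u) = (`|y - x| + (c r + c s)) *: u.
  rewrite !scalerDl -yx opprB [c r *: u - x]addrC addrACA.
  by rewrite [c s *: u + _]addrC.
rewrite normrZ u1 mulr1 ger0_norm ?addr_ge0 //.
lra.
Qed.

(** Points of the ball far out on the ray from [O] through [p] approach the bound. *)
Lemma outer_radius_ball O U rho p r : 0 < rho -> U `<=` ball O rho -> 0 < r ->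
  ball p r `<=` U -> mdist O p + r <= outer_radius O U.
Proof.
move=> rho0 UO r0 pU; apply/ler_addgt0Pr => e e0.
have [u u1 yx] := exists_direction (p - O).
pose c := Num.max (r - e) 0.
have [/andP[c0 cr] lec] : 0 <= c < r /\ r - e <= c.
  by rewrite /c; case: (leP (r - e) 0) => ?; split; lra.
have pb : ball p r (p + c *: u : X).
  by rewrite ballEmdist /= normed_mdistE addrAC subrr add0r normrZ u1
    mulr1 ger0_norm.
have := le_outer_radius rho0 UO (pU _ pb); rewrite !normed_mdistE.
have -> : p + c *: u - O = (`|p - O| + c) *: u.
  by rewrite scalerDl -yx addrAC.
rewrite normrZ u1 mulr1 ger0_norm ?addr_ge0 //.
lra.
Qed.

End NormedMetric.

(** * Monotonicity in the configuration, and configurations inside a stable set *)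

Section Subconfigurations.
Context {R : realType} {X : metricType R}.
Implicit Types (sigma : R) (O p : X) (P : {fset X}).

(** Radii as a function on all of [X], so that they can be transported between finite sets and
    evaluated at named points. *)
Definition extend0 P (r : P -> R) (x : X) : R := oapp r 0 (insub x).

Lemma extend0_val P (r : P -> R) (p : P) : extend0 r (val p) = r p.
Proof. by rewrite /extend0 valK. Qed.

Lemma extend0_out P (r : P -> R) x : x \notin P -> extend0 r x = 0.
Proof. by move=> xP; rewrite /extend0 insubF //; exact: negbTE. Qed.

Lemma sum_extend0 P (r : P -> R) : \sum_(p : P) r p = \sum_(x <- P) extend0 r x.
Proof.
by rewrite big_seq_fsetE; apply: eq_bigr => p _; rewrite extend0_val.
Qed.

Lemma ball0 p : ball p 0 = set0 :> set X.
Proof.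
by apply/seteqP; split=> // x; rewrite ballEmdist /= ltNge mdist_ge0.
Qed.

Lemma M_sigma_ge0 sigma O P : (0 <= M_sigma sigma O P)%E.
Proof.
apply: ereal_sup_ubound; exists (fun=> 0) => /=.
  split=> [p|p p' _]; first by rewrite lexx ler01.
  by rewrite !ball0 setI0.
rewrite /F_sigma ball_union0 diameter0 outer_radius0 big1 // addr0.
by rewrite min_l ?invr_ge0 // mulr0 subr0.
Qed.

(** Extension by 0 adds only empty balls and zero summands, so [F_sigma] keeps its value. *)
Lemma M_sigma_mono sigma O P P' :
  (P' `<=` P)%fset -> (M_sigma sigma O P' <= M_sigma sigma O P)%E.
Proof.
move=> /fsubsetP sub; apply: ge_ereal_sup => _ [r [r01 rdisj] <-].
apply: ereal_sup_ubound; exists (fun p : P => extend0 r (val p)).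
  split=> [p|p p' pp'].
    rewrite /extend0; case: insubP => [u _ _|_] /=; first exact: r01.
    by rewrite lexx ler01.
  rewrite /extend0; case: insubP => [u _ uE|_] /=; last by rewrite ball0 set0I.
  case: insubP => [u' _ uE'|_] /=; last by rewrite ball0 setI0.
  have := rdisj u u'; rewrite uE uE'; apply; apply: contra_neq pp' => uu'.
  by apply: val_inj; rewrite /= -uE -uE' uu'.
rewrite /F_sigma.
have -> : ball_union (fun p : P => extend0 r (val p)) = ball_union r.
  apply/seteqP; split=> x [p].
    rewrite /extend0; case: insubP => [u _ <- ux|_] /=; first by exists u.
    by rewrite ball0.
  move=> px; exists [` sub _ (valP p)]; rewrite /= extend0_val //.
congr (_ - _)%:E; rewrite (sum_extend0 r).
rewrite -(big_seq_fsetE _ P xpredT (extend0 r)) /=.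
apply/esym/big_fset_incl; first exact/fsubsetP.
by move=> x _ /extend0_out.
Qed.

Lemma config_family_sub sigma O P k : O \in P ->
  infty_one_stable sigma O [set` P] ->
  exists2 P', config_family sigma O k P' & (P' `<=` P)%fset.
Proof.
move=> OP stable.
have /choice[q qP] p : exists q, p \in P ->
    [/\ Delta_sigma sigma p q, q.1 \in P & q.2 \in P].
  have [pP|] := boolP (p \in P); last by exists (p, p).
  (* This [L] exceeds 1 and is large enough for the ball around [O] to contain [p]. *)
  have L1 : 1 < 2 + mdist O p by have := mdist_ge0 O p; lra.
  have [|q [? ? ?]] := stable _ L1 p; last by exists q.
  by split=> //; rewrite ballEmdist /= ltrDr.
elim: k => [|k [Pk Pk_config /fsubsetP sub]].
  by exists [fset O] => //; rewrite fsub1set.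
exists (Pk `|` [fset (q p).1 | p in Pk] `|` [fset (q p).2 | p in Pk])%fset.
  by exists Pk; split=> //; exists q; split=> // p /sub/qP[].
apply/fsubsetP => x; rewrite !in_fsetE => /orP[/orP[/sub //|]|].
  by case/imfsetP => p /= /sub/qP[_ ? _] ->.
by case/imfsetP => p /= /sub/qP[_ _ ?] ->.
Qed.

Lemma OneMinM_eq0 sigma O P k : O \in P ->
  infty_one_stable sigma O [set` P] -> M_sigma sigma O P = 0%E ->
  OneMinM sigma O k = 0%E.
Proof.
move=> OP stable M0; apply/eqP; rewrite eq_le; apply/andP; split.
  have [P' P'_config sub] := config_family_sub k OP stable.
  apply: le_trans (ereal_inf_lbound _) _; first by exists P'.
  by rewrite -M0; exact: M_sigma_mono.
by apply/ereal_infP => _ [P' _ <-]; exact: M_sigma_ge0.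
Qed.

End Subconfigurations.

(** * Linear constraints satisfied by admissible radii *)

Section Admissible.
Context {R : realType} {V : normedModType R}.
Hypothesis V_nontrivial : exists v : V, v != 0.
Local Notation X := (normed_metric V).
Variables (O : X) (P : {fset X}) (r : P -> R).
Hypothesis r_adm : admissible r.
Local Notation f := (extend0 r).

Lemma extend0_itv x : 0 <= f x <= 1.
Proof.
rewrite /extend0; case: insubP => [u _ _|_] /=; first exact: r_adm.1.
by rewrite lexx ler01.
Qed.

Lemma extend0_sub x : x \in P -> ball x (f x) `<=` ball_union r.
Proof.
by move=> xP y; exists [` xP]; rewrite -extend0_val.
Qed.

Lemma extend0_disjoint x y : x \in P -> y \in P -> x != y ->
  0 < f x -> 0 < f y -> f x + f y <= mdist x y.
Proof.
move=> xP yP xy fx fy; apply: disjoint_ball_mdist => //.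
have := r_adm.2 [` xP] [` yP]; rewrite -!extend0_val /=; apply.
by apply: contra_neq xy => /(congr1 val).
Qed.

Let bounded : exists2 rho, 0 < rho & ball_union r `<=` ball O rho.
Proof. by apply: ball_union_bounded => p; case/andP: (r_adm.1 p). Qed.

Lemma extend0_diameter x y : x \in P -> y \in P -> 0 < f x -> 0 < f y ->
  mdist x y + (f x + f y) <= diameter (ball_union r).
Proof.
move=> xP yP fx fy; have [rho _ UO] := bounded.
by apply: (diameter_balls V_nontrivial UO) => //; exact: extend0_sub.
Qed.

Lemma extend0_outer_radius x : x \in P -> 0 < f x ->
  mdist O x + f x <= outer_radius O (ball_union r).
Proof.
move=> xP fx; have [rho rho0 UO] := bounded.
by apply: (outer_radius_ball V_nontrivial rho0 UO) => //; exact: extend0_sub.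
Qed.

End Admissible.

(** * The positive root of the cubic *)

Lemma sigma_root (R : realType) : exists2 s : R,
  [/\ 8 * s ^+ 3 + 4 * s ^+ 2 - 3 * s - 3 = 0 &
      (72 * 1000 + 655) / 10 ^+ 5 - 49 / 10 ^+ 7 <= s
        <= (72 * 1000 + 655) / 10 ^+ 5] &
  unique (fun s : R => 0 < s /\ 8 * s ^+ 3 + 4 * s ^+ 2 - 3 * s - 3 = 0) s.
Proof.
pose p : {poly R} := 8 *: 'X^3 + 4 *: 'X^2 - 3 *: 'X - 3%:P.
have pE x : p.[x] = 8 * x ^+ 3 + 4 * x ^+ 2 - 3 * x - 3.
  by rewrite !hornerE.
have [||s s_itv /rootP] := @poly_ivt R p
    ((72 * 1000 + 655) / 10 ^+ 5 - 49 / 10 ^+ 7) ((72 * 1000 + 655) / 10 ^+ 5).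
- lra.
- by rewrite !pE; apply/andP; split; lra.
rewrite pE => sE; exists s => //; split; first by split=> //; lra.
move=> u [u0 uE].
(* Cross-multiplying by [u] and [s] cancels the linear terms and leaves a cofactor that is positive
   for positive roots. *)
have : (s - u) * (8 * (s * u) * (s + u) + 4 * (s * u) + 3) =
    u * (8 * s ^+ 3 + 4 * s ^+ 2 - 3 * s - 3) -
    s * (8 * u ^+ 3 + 4 * u ^+ 2 - 3 * u - 3) by ring.
rewrite sE uE !mulr0 subrr => /eqP; rewrite mulf_eq0 subr_eq0 => /orP[/eqP //|].
have su : 0 < s * u by rewrite mulr_gt0 //; lra.
have : 0 < 8 * (s * u) * (s + u) by rewrite !mulr_gt0 //; lra.
by move=> ? /eqP; lra.
Qed.

Lemma mdist_plane (R : realType) (a b c d : R) :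
  mdist ((a, b) : normed_metric (R^o * R^o)%type) (c, d) =
  Num.max `|c - a| `|d - b|.
Proof. by []. Qed.

(** * The quadrilateral in the plane *)

Section Configuration.
Context {R : realType} (s : R).
Local Notation X := (normed_metric (R^o * R^o)%type).
Hypotheses (sE : 8 * s ^+ 3 + 4 * s ^+ 2 - 3 * s - 3 = 0)
  (s_itv : 29 / 40 < s < 8 / 11).
Let t := 8 * s ^+ 2 - 2 * s - 2.

(** The second coordinates realise the distances from [p0] to [p2] and [p3], the first coordinates
    the other four. *)
Let p0 : X := (0, 0).
Let p1 : X := (1, 1).
Let p2 : X := (2 - 2 * s, 2 * s).
Let p3 : X := (1 - 2 * s, t).

Let s_gt : 29 / 40 < s. Proof. by case/andP: s_itv. Qed.
Let s_lt : s < 8 / 11. Proof. by case/andP: s_itv. Qed.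
Let t_gt : 3 / 4 < t. Proof. by case/andP: (side_itv s_itv). Qed.
Let t_lt : t < 7 / 9. Proof. by case/andP: (side_itv s_itv). Qed.

Let maxl (x y a : R) : `|x| = a -> `|y| <= a -> Num.max `|x| `|y| = a.
Proof. by move=> -> ?; rewrite max_l. Qed.

Let maxr (x y a : R) : `|x| <= a -> `|y| = a -> Num.max `|x| `|y| = a.
Proof. by move=> ? ->; rewrite max_r. Qed.

Ltac dist_lra := move: s_gt s_lt t_gt t_lt; clearbody t; case: ger0P; lra.

Let d01 : mdist p0 p1 = 1.
Proof. by rewrite mdist_plane; apply: maxl; dist_lra. Qed.

Let d02 : mdist p0 p2 = 2 * s.
Proof. by rewrite mdist_plane; apply: maxr; dist_lra. Qed.

Let d03 : mdist p0 p3 = t.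
Proof. by rewrite mdist_plane; apply: maxr; dist_lra. Qed.

Let d12 : mdist p1 p2 = 2 * s - 1.
Proof. by rewrite mdist_plane; apply: maxl; dist_lra. Qed.

Let d13 : mdist p1 p3 = 2 * s.
Proof. by rewrite mdist_plane; apply: maxl; dist_lra. Qed.

Let d23 : mdist p2 p3 = 1.
Proof. by rewrite mdist_plane; apply: maxl; dist_lra. Qed.

Let neq (x y : X) : 0 < mdist x y -> x != y.
Proof. by rewrite mdist_gt0. Qed.

Let p01 : p0 != p1. Proof. by apply: neq; rewrite d01. Qed.
Let p02 : p0 != p2. Proof. by apply: neq; rewrite d02; move: s_gt; lra. Qed.
Let p03 : p0 != p3. Proof. by apply: neq; rewrite d03; move: t_gt; lra. Qed.
Let p12 : p1 != p2. Proof. by apply: neq; rewrite d12; move: s_gt; lra. Qed.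
Let p13 : p1 != p3. Proof. by apply: neq; rewrite d13; move: s_gt; lra. Qed.
Let p23 : p2 != p3. Proof. by apply: neq; rewrite d23. Qed.

Definition config : {fset X} := (p0 |` (p1 |` (p2 |` [fset p3])))%fset.

Let in_config :
  [/\ p0 \in config, p1 \in config, p2 \in config & p3 \in config].
Proof. by split; rewrite !in_fsetE eqxx ?orbT. Qed.

Lemma origin_config : ((0, 0) : X) \in config.
Proof. by case: in_config. Qed.

Let notin_tails : [/\ p0 \notin (p1 |` (p2 |` [fset p3]))%fset,
  p1 \notin (p2 |` [fset p3])%fset & p2 \notin [fset p3]%fset].
Proof. by split; rewrite !in_fsetE ?negb_or ?p01 ?p02 ?p03 ?p12 ?p13 ?p23. Qed.

Let sum_config (f : X -> R) :
  \sum_(x <- config) f x = f p0 + f p1 + f p2 + f p3.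
Proof.
have [n0 n1 n2] := notin_tails.
by rewrite !big_fsetU1 //= big_seq_fset1 !addrA.
Qed.

Lemma card_config : #|` config| = 4%N.
Proof.
by have [n0 n1 n2] := notin_tails; rewrite !cardfsU1 cardfs1 n0 n1 n2.
Qed.

(** The two neighbours of a vertex are the ends of a diagonal of length [2 * s], and all sides are
    at most 1. *)
Lemma config_stable : infty_one_stable s p0 [set` config].
Proof.
have [c0 c1 c2 c3] := in_config.
move=> L _ p [/=]; rewrite !in_fsetE => /or4P[] /eqP -> _;
  [exists (p1, p3)|exists (p0, p2)|exists (p1, p3)|exists (p0, p2)];
  split=> //; split=> /=;
  rewrite ?(metric_sym p1 p0) ?(metric_sym p2 p1) ?(metric_sym p3 p0)
    ?(metric_sym p3 p2) ?d01 ?d02 ?d03 ?d12 ?d13 ?d23 //;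
  move: s_gt s_lt t_lt; clearbody t; lra.
Qed.

Lemma M_config : M_sigma s p0 config = 0%E.
Proof.
apply/eqP; rewrite eq_le M_sigma_ge0 andbT.
apply/ereal_supP => _ [r r_adm <-].
rewrite lee_fin subr_le0 sum_extend0 sum_config.
have V0 : exists v : (R^o * R^o)%type, v != 0 by exists p1; rewrite eq_sym.
have [c0 c1 c2 c3] := in_config.
set f := extend0 r; set D := diameter _; set Q := outer_radius _ _.
have f_itv x : 0 <= f x <= 1 by exact: extend0_itv.
have disj x y d : x \in config -> y \in config -> x != y -> mdist x y = d ->
    (0 < f x) ==> (0 < f y) ==> (f x + f y <= d).
  move=> xP yP xy <-; apply/implyP => fx; apply/implyP => fy.
  exact: extend0_disjoint.
have diam x y d : x \in config -> y \in config -> mdist x y = d ->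
    (0 < f x) ==> (0 < f y) ==> (d + (f x + f y) <= D).
  move=> xP yP <-; apply/implyP => fx; apply/implyP => fy.
  exact: (extend0_diameter V0 p0).
have diam1 x : x \in config -> (0 < f x) ==> (2 * f x <= D).
  (* A single ball is the pair of a point with itself, at distance 0. *)
  move=> xP; have := diam x x 0 xP xP (mdistxx x).
  by case: (0 < f x); rewrite // add0r mulr_natl mulr2n.
have rad x d : x \in config -> mdist p0 x = d -> (0 < f x) ==> (d + f x <= Q).
  by move=> xP <-; apply/implyP => fx; exact: (extend0_outer_radius V0).
have rad0 : (0 < f p0) ==> (f p0 <= Q).
  by have := rad p0 0 c0 (mdistxx p0); rewrite add0r.
have s0 : 0 < 2 * s by move: s_gt; lra.
(* Clearing [2 * s] and splitting the minimum gives one program for the diameter and one for the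
   outer radius. *)
rewrite mulrC ler_pdivlMr // mulrC le_min; apply/andP; split.
  apply: (@LP_diameter _ s t); first [exact: side_itv | exact: diameter_ge0
    | exact: f_itv | exact: diam1 | exact: disj | exact: diam | by []].
apply: (@LP_radius _ s t); first [exact: outer_radius_ge0 | exact: f_itv
  | exact: rad0 | exact: rad | exact: disj | by []].
Qed.

End Configuration.

Theorem theorem4p5 (R : realType) :
  exists sigma : R,
    unique (fun s : R => 0 < s /\ 8 * s ^+ 3 + 4 * s ^+ 2 - 3 * s - 3 = 0) sigma
    /\ `|sigma - (72 * 1000 + 655) / 10 ^+ 5| < 5 / 10 ^+ 6
    /\ exists (X : metricType R) (O : X) (P : {fset X}),
         [/\ #|` P| = 4%N, O \in P, infty_one_stable sigma O [set` P],
             M_sigma sigma O P = 0%E &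
             forall k : nat, OneMinM sigma O k = 0%E].
Proof.
have [s [sE s_itv s_unique]] := sigma_root R.
exists s; split => //; split.
  by rewrite ltr_norml; apply/andP; split; lra.
have s_itv' : 29 / 40 < s < 8 / 11 by apply/andP; split; lra.
exists (normed_metric (R^o * R^o)%type), (0, 0), (config s).
have stable := config_stable s_itv'; have M0 := M_config sE s_itv'.
have O_in := origin_config s.
split=> //; first exact: card_config.
by move=> k; exact: OneMinM_eq0 M0.
Qed.
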